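(* Let $\mathcal{A} \in \mathbb{C}^{I_1 \times \cdots \times I_N \times I_1 \times \cdots \times I_N}$ be a deterministic positive definite (PD) tensor, and let $\mathcal{X} \in \mathbb{C}^{I_1 \times \cdots \times I_N \times I_1 \times \cdots \times I_N}$ be a random Hermitian tensor. Then $$\mathrm{Pr}\left(\mathcal{X} \not\preceq \mathcal{A}\right) \leq \mathrm{Tr}\left(\mathbb{E}[\mathcal{X}^2]\star_N \mathcal{A}^{-2}\right).$$
   Context: Square tensors in $\mathbb{C}^{I_1 \times \cdots \times I_N \times I_1 \times \cdots \times I_N}$ are multiplied by the Einstein product $(\mathcal{X}\star_N\mathcal{Y})_{i_1,\dots,i_N,k_1,\dots,k_N} = \sum_{j_1,\dots,j_N} x_{i_1,\dots,i_N,j_1,\dots,j_N}\,y_{j_1,\dots,j_N,k_1,\dots,k_N}$. The identity tensor $\mathcal{I}$ has entries $\prod_{k}\delta_{i_k,j_k}$. Powers and inverses are taken with respect to $\star_N$. The conjugate transpose is $(\mathcal{X}^{\mathrm H})_{j_1,\dots,j_N,i_1,\dots,i_N}=\overline{x_{i_1,\dots,i_N,j_1,\dots,j_N}}$, and $\mathcal{X}$ is Hermitian if $\mathcal{X}^{\mathrm H}=\mathcal{X}$. The trace is $\mathrm{Tr}(\mathcal{X})=\sum_{i_1,\dots,i_N}x_{i_1,\dots,i_N,i_1,\dots,i_N}$. (Equivalently, these are square matrices of size $\prod_{j=1}^N I_j$ under unfolding, with the usual matrix product, trace, eigenvalues, etc.) A Hermitian tensor is PD if all its eigenvalues are positive and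 semipositive definite (SPD) if all its eigenvalues are nonnegative. $\mathcal{A}\preceq\mathcal{B}$ means $\mathcal{B}-\mathcal{A}$ is SPD, and $\mathcal{A}\not\preceq\mathcal{B}$ means $\mathcal{B}-\mathcal{A}$ is not SPD. Expectations are taken entrywise and are understood to exist. *)

(* Defs.v *)
From HB Require Import structures.
From mathcomp Require Import all_boot all_order all_algebra.
From mathcomp Require Import all_classical all_reals all_analysis.
From mathcomp Require Import complex.

Set Implicit Arguments.
Unset Strict Implicit.
Unset Printing Implicit Defensive.

Import Order.TTheory GRing.Theory Num.Theory.

Local Open Scope ring_scope.
Local Open Scope complex_scope.

Notation mindex d := {dffun forall k, 'I_(d k)}.

(* [vtensor C d] is C^(I_1 x ... x I_N) and [tensor C d] is
   C^(I_1 x ... x I_N x I_1 x ... x I_N), where d k is the k-th dimension.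
   Sums, differences and scalings are those of {ffun _}.  Its ring operations
   (1, *, ^+) are entrywise and are not used; see [tone], [tmul], [tpow]
   and [tinv]. *)
Notation vtensor C d := {ffun mindex d -> C}.
Notation tensor C d := {ffun mindex d * mindex d -> C}.

Section TensorAlgebra.
Variables (C : numClosedFieldType) (N : nat) (d : 'I_N -> nat).
Implicit Types (A B : tensor C d) (v : vtensor C d) (l : C).

Definition tone : tensor C d :=
  [ffun ij : mindex d * mindex d => \prod_(k < N) (ij.1 k == ij.2 k)%:R].

Definition tmul A B : tensor C d :=
  [ffun ik => \sum_(j : mindex d) A (ik.1, j) * B (j, ik.2)].

Definition tpow A (n : nat) : tensor C d := iter n (tmul A) tone.

(* The two-sided inverse, which is unique; 0 if A is not invertible. *)
Definition tinv A : tensor C d :=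
  xget 0 [set B | tmul A B = tone /\ tmul B A = tone]%classic.

Definition tadj A : tensor C d := [ffun ji => (A (ji.2, ji.1))^*%R].

Definition thermitian A : Prop := tadj A = A.

Definition ttrace A : C := \sum_(i : mindex d) A (i, i).

Definition tapp A v : vtensor C d :=
  [ffun i => \sum_(j : mindex d) A (i, j) * v j].

Definition teigenvalue A l : Prop :=
  exists2 v : vtensor C d, v != 0 & tapp A v = [ffun i => l * v i].

(* In the partial order of C, 0 < l (resp. 0 <= l) says that l is real and
   positive (resp. nonnegative). *)
Definition tPD A : Prop := thermitian A /\ forall l, teigenvalue A l -> 0 < l.

Definition tSPD A : Prop := thermitian A /\ forall l, teigenvalue A l -> 0 <= l.

Definition tle A B : Prop := tSPD (B - A).

End TensorAlgebra.

Arguments tone {C N d}.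

Section RandomTensors.
Context (disp : measure_display) (T : measurableType disp) (R : realType).
Variable P : probability T R.

Definition cmeasurable (Y : T -> R[i]) : Prop :=
  measurable_fun [set: T]%classic (fun w => complex.Re (Y w)) /\
  measurable_fun [set: T]%classic (fun w => complex.Im (Y w)).

Definition cintegrable (Y : T -> R[i]) : Prop :=
  P.-integrable [set: T]%classic (fun w => (complex.Re (Y w))%:E) /\
  P.-integrable [set: T]%classic (fun w => (complex.Im (Y w))%:E).

Definition cexpectation (Y : T -> R[i]) : R[i] :=
  fine ('E_P[fun w => complex.Re (Y w)]) +i*
  fine ('E_P[fun w => complex.Im (Y w)]).

Variables (N : nat) (d : 'I_N -> nat).
Implicit Types X : T -> tensor R[i] d.

Definition random_tensor X : Prop :=
  forall ij, cmeasurable (fun w => X w ij).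

Definition tintegrable X : Prop :=
  forall ij, cintegrable (fun w => X w ij).

Definition texpectation X : tensor R[i] d :=
  [ffun ij => cexpectation (fun w => X w ij)].

End RandomTensors.

(* Main.v *)
Require Import Defs.
From HB Require Import structures.
From mathcomp Require Import all_boot all_order all_algebra.
From mathcomp Require Import all_classical all_reals all_analysis.
From mathcomp Require Import complex.
From mathcomp Require Import ring measurable_realfun.

(* If X <= A fails, some vector v has v^* A v < v^* X v.  In an orthonormal
   eigenbasis of A, with eigenvalues a_i > 0, weighted AM-GM applied to the
   terms of v^* X v gives 1 <= sum_ij |x_ij|^2 / (a_i a_j), and AM-GM on
   1 / (a_i a_j) bounds this by sum_ij |x_ij|^2 / a_j^2 = Tr (X^2 A^-2).  The
   latter being nonnegative for every Hermitian X, Markov's inequality and the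
   linearity of the expectation conclude.  The event is measurable because a
   Hermitian H is SPD iff the characteristic polynomial of -H has nonnegative
   coefficients, and these are polynomials in the entries of H. *)

Set Implicit Arguments.
Unset Strict Implicit.
Unset Printing Implicit Defensive.

Import Order.TTheory GRing.Theory Num.Theory.

Local Open Scope ring_scope.
Local Open Scope complex_scope.
Local Open Scope sesquilinear_scope.

(** * Hermitian forms and the trace bound for matrices *)

Section HermitianMatrices.
Variable C : numClosedFieldType.

Lemma real_AGM2 (x y : C) : x \is Num.real -> y \is Num.real ->
  x * y *+ 2 <= x ^+ 2 + y ^+ 2.
Proof.
move=> xr yr; rewrite -subr_ge0.
have -> : x ^+ 2 + y ^+ 2 - x * y *+ 2 = (x - y) ^+ 2 by ring.
by rewrite real_exprn_even_ge0 ?realB.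
Qed.

(** Let [S < Q] be the two forms and [t] the symmetric sum of [|X i j|^2 / (a i * a j)]. Termwise
    AM-GM gives [2 Q S <= S^2 (t + 1)], and [Q > S > 0] then forces [1 <= t]. The factor [S] takes
    the place of a normalisation of [v]. *)
Lemma diag_form_trace_ge1 n (a : 'I_n -> C) (X : 'M[C]_n) (v : 'I_n -> C) :
    (forall i, 0 < a i) -> X^t* = X ->
    \sum_i a i * `|v i| ^+ 2 < \sum_i \sum_j (v i)^* * X i j * v j ->
  1 <= \sum_i \sum_j `|X i j| ^+ 2 / a j ^+ 2.
Proof.
move=> a_gt0 Xherm; set S := \sum_i a i * _; set Q := \sum_i _ => ltSQ.
have aN0 i : a i != 0 by rewrite gt_eqF.
have avge0 i : 0 <= a i * `|v i| ^+ 2 by rewrite mulr_ge0 ?exprn_ge0 // ltW.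
have S_ge0 : 0 <= S by apply: sumr_ge0.
(* [S = 0] would force [v = 0], hence [Q = 0], against the strict inequality. *)
have S_gt0 : 0 < S.
  rewrite lt_def S_ge0 andbT; apply: contraTneq ltSQ => S0.
  have v0 i : v i = 0.
    have /eqP := (psumr_eq0P (fun i _ => avge0 i) S0) i isT.
    by rewrite mulf_eq0 (negPf (aN0 i)) /= expf_eq0 /= normr_eq0 => /eqP.
  rewrite S0 (_ : Q = 0) ?ltxx // /Q big1 // => i _; rewrite big1 // => j _.
  by rewrite (v0 j) mulr0.
have Xsym i j : `|X i j| = `|X j i|.
  by rewrite -{1}Xherm !mxE norm_conjC.
set t := \sum_i \sum_j `|X i j| ^+ 2 / (a i * a j).
have t_le : t <= \sum_i \sum_j `|X i j| ^+ 2 / a j ^+ 2.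
  (* After doubling, one copy of the right-hand sum is transposed, which sets
     [1 / a i ^+ 2 + 1 / a j ^+ 2] against [2 / (a i * a j)]. *)
  rewrite -(ler_pM2r (ltr0n _ 2)) !mulr_natr [leRHS]mulr2n.
  rewrite {2}exchange_big -big_split -sumrMnl; apply: ler_sum => i _ /=.
  rewrite -big_split -sumrMnl; apply: ler_sum => j _ /=.
  rewrite [`|X j i|]Xsym -mulrDr -mulrnAr ler_wpM2l ?exprn_ge0 // addrC -!exprVn.
  by rewrite invfM real_AGM2 // ger0_real // invr_ge0 ltW.
apply: le_trans t_le.
have QS : Q * S *+ 2 <= S ^+ 2 * (t + 1).
  have /ger0_norm <- : 0 <= Q by exact: ltW (lt_trans S_gt0 ltSQ).
  apply: (@le_trans _ _
    ((\sum_i \sum_j `|v i| * `|X i j| * `|v j|) * S *+ 2)).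
    rewrite lerMn2r ler_pM2r //=; apply: le_trans (ler_norm_sum _ _ _) _.
    apply: ler_sum => i _; apply: le_trans (ler_norm_sum _ _ _) _.
    by apply: ler_sum => j _; rewrite !normrM norm_conjC.
  have -> : S ^+ 2 * (t + 1) = \sum_i \sum_j
      (S ^+ 2 * (`|X i j| ^+ 2 / (a i * a j)) +
       (a i * `|v i| ^+ 2) * (a j * `|v j| ^+ 2)).
    rewrite mulrDr mulr1 {2}expr2 {2}/S mulr_suml mulr_sumr -big_split.
    apply: eq_bigr => i _ /=.
    by rewrite big_split /= -!mulr_sumr.
  rewrite mulr_suml -sumrMnl; apply: ler_sum => i _.
  rewrite mulr_suml -sumrMnl; apply: ler_sum => j _.
  have m_gt0 : 0 < a i * a j by rewrite mulr_gt0.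
  rewrite -(ler_pM2r m_gt0); set x := `|X i j|; set u := `|v i|; set w := `|v j|.
  (* Multiplied by [a i * a j], the inequality is AM-GM for [S * x] and [a i * a j * (u * w)]. *)
  have -> : (u * x * w * S *+ 2) * (a i * a j) =
      (S * x) * (a i * a j * (u * w)) *+ 2 by ring.
  have -> : (S ^+ 2 * (x ^+ 2 / (a i * a j)) + a i * u ^+ 2 * (a j * w ^+ 2)) *
      (a i * a j) = (S * x) ^+ 2 + (a i * a j * (u * w)) ^+ 2.
    by field; rewrite !aN0.
  by apply: real_AGM2; rewrite ger0_real ?mulr_ge0 ?S_ge0 ?normr_ge0 // ltW.
have {}QS : S * S *+ 2 <= S ^+ 2 * (t + 1).
  by apply: le_trans QS; rewrite lerMn2r ler_pM2r //= ltW.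
rewrite -(lerD2r 1) -(@ler_pM2l _ (S ^+ 2)) ?exprn_gt0 //.
by apply: le_trans QS; rewrite -[1 + 1]mulr2n mulrnAr mulr1.
Qed.

Lemma trC_mulmx_gt0 n (v : 'cV[C]_n) : v != 0 -> 0 < (v^t* *m v) 0 0.
Proof.
move=> vN0; have [i viN0] : exists i, v i 0 != 0.
  apply/existsP; apply: contraNT vN0; rewrite negb_exists => /forallP v0.
  by apply/eqP/matrixP => i j; rewrite ord1 mxE; have /negPn/eqP := v0 i.
rewrite mxE (bigD1 i) //= ltr_wpDr //; first apply: sumr_ge0 => j _;
  by rewrite !mxE -normCKC ?exprn_ge0 // exprn_gt0 // normr_gt0.
Qed.

Lemma hermitian_form_real n (M : 'M[C]_n) (v : 'cV[C]_n) :
  M^t* = M -> (v^t* *m M *m v) 0 0 \is Num.real.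
Proof.
move=> Mh; apply/CrealP.
have : ((v^t* *m M *m v)^t*) 0 0 = (v^t* *m M *m v) 0 0.
  by rewrite !(trmx_mul, map_mxM) /= trmxCK Mh mulmxA.
by rewrite !mxE.
Qed.

Section PositiveDefiniteMatrix.
Variables (n : nat) (A : 'M[C]_n).
Hypothesis A_herm : A^t* = A.
Hypothesis A_pos : forall l, eigenvalue A l -> 0 < l.

Let U := spectralmx A.
Let a : 'rV[C]_n := spectral_diag A.

Let UU : U *m U^t* = 1%:M.
Proof. exact/unitarymxP/spectral_unitarymx. Qed.

Let AE : A = U^t* *m diag_mx a *m U.
Proof.
have /orthomx_spectralP : A \is normalmx by apply/normalmxP; rewrite A_herm.
by rewrite invmx_unitary ?spectral_unitarymx.
Qed.

Let a_gt0 i : 0 < a 0 i.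
Proof.
(* [eigenvalue] is about row vectors, and the rows of [U] are left eigenvectors of [A]. *)
apply: A_pos; apply/eigenvalueP; exists (row i U).
  rewrite {1}AE -row_mul !mulmxA UU mul1mx row_mul row_diag_mx -scalemxAl.
  by rewrite -rowE.
(* A zero row of [U] would put a zero on the diagonal of [U *m B = 1%:M]. *)
have := spectral_unit A; rewrite -row_free_unit => /row_freeP [B UB].
apply/eqP => Ui0; have /matrixP /(_ 0 i) := congr1 (row i) UB.
rewrite row_mul Ui0 mul0mx !mxE eqxx => /esym /eqP; exact/negP/oner_neq0.
Qed.

Let iA := U^t* *m diag_mx (\row_i (a 0 i)^-1) *m U.

Let mulAi : A *m iA = 1%:M.
Proof.
rewrite AE /iA !mulmxA -(mulmxA _ U) UU mulmx1 -(mulmxA _ (diag_mx a)).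
rewrite mulmx_diag (_ : diag_mx _ = 1%:M) ?mulmx1 ?(mulmx1C UU) //.
by apply/matrixP => i j; rewrite !mxE mulfV // gt_eqF.
Qed.

Lemma posdef_unitmx : A \in unitmx.
Proof. by have [] := mulmx1_unit mulAi. Qed.

Let invAE : invmx A = iA.
Proof. by rewrite -[LHS]mulmx1 -mulAi mulKmx // posdef_unitmx. Qed.

Variable X : 'M[C]_n.
Hypothesis X_herm : X^t* = X.

(** [X] in the orthonormal basis formed by the columns of [U^t*], which diagonalises [A]. *)
Let Y := U *m X *m U^t*.

Let Y_herm : Y^t* = Y.
Proof. by rewrite /Y !(trmx_mul, map_mxM) trmxCK /= X_herm mulmxA. Qed.

(** By cyclicity the trace is that of [Y *m Y] times the diagonal matrix of the [a 0 j ^- 2]; since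
    [Y] is Hermitian, the products [Y j i * Y i j] are squared moduli. *)
Let traceE : \tr (X *m X *m (invmx A *m invmx A)) =
  \sum_i \sum_j `|Y i j| ^+ 2 / a 0 j ^+ 2.
Proof.
have -> : X = U^t* *m Y *m U.
  by rewrite /Y !mulmxA (mulmx1C UU) mul1mx -mulmxA (mulmx1C UU) mulmx1.
rewrite invAE /iA; set D := diag_mx _; move: (Y) Y_herm => Z Z_herm.
rewrite !mulmxA mxtrace_mulC !mulmxA UU mul1mx.
rewrite !(=^~ mulmxA _ U (U^t*)) UU !mulmx1.
rewrite -(mulmxA _ D) mulmx_diag exchange_big; apply: eq_bigr => j _ /=.
rewrite mul_mx_diag !mxE mulr_suml; apply: eq_bigr => i _.
have -> : Z j i = (Z i j)^*%R by rewrite -{1}Z_herm !mxE.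
by rewrite normCK -expr2 exprVn (mulrC (Z i j)).
Qed.

Lemma trace_sqr_ge0 : 0 <= \tr (X *m X *m (invmx A *m invmx A)).
Proof.
rewrite traceE; apply: sumr_ge0 => i _; apply: sumr_ge0 => j _.
by rewrite divr_ge0 ?exprn_ge0 // ltW.
Qed.

(** In the coordinates [U *m v] the form of [A] is a weighted sum of squares and that of [X] has
    matrix [Y], so the diagonal case applies. *)
Lemma trace_sqr_ge1 (v : 'cV[C]_n) :
  (v^t* *m A *m v) 0 0 < (v^t* *m X *m v) 0 0 ->
  1 <= \tr (X *m X *m (invmx A *m invmx A)).
Proof.
move=> ltAX; rewrite traceE.
apply: (@diag_form_trace_ge1 _ (a 0) Y (fun i => (U *m v) i 0)) => //.
set w := U *m v; have wE : w^t* = v^t* *m U^t* by rewrite trmx_mul map_mxM.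
have formE (M : 'M[C]_n) : (w^t* *m M *m w) 0 0 =
    \sum_i \sum_j (w i 0)^* * M i j * w j 0.
  rewrite mxE exchange_big; apply: eq_bigr => j _ /=; rewrite mxE mulr_suml.
  by apply: eq_bigr => i _; rewrite !mxE.
rewrite -formE wE /Y /w !mulmxA.
rewrite !(=^~ mulmxA _ (U^t*) U) (mulmx1C UU) !mulmx1.
apply: le_lt_trans ltAX; rewrite {1}AE !mulmxA -wE -mulmxA formE.
rewrite le_eqVlt; apply/orP; left; apply/eqP; apply: eq_bigr => i _.
rewrite (bigD1 i) //= big1 ?addr0 => [|j jNi].
  by rewrite !mxE eqxx mulr1n normCKC mulrCA mulrA.
by rewrite !mxE eq_sym (negPf jNi) mulr0n mulr0 mul0r.
Qed.

End PositiveDefiniteMatrix.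
End HermitianMatrices.

(** * Unfolding of tensors into matrices *)

Section Unfolding.
Variables (C : numClosedFieldType) (N : nat) (d : 'I_N -> nat).
Implicit Types (A B H X : tensor C d) (l : C).

Let n := #|{: mindex d}|.

(** Rows and columns share one enumeration of the multi-indices, so products, traces and adjoints
    carry over whatever its order. *)
Definition tunfold A : 'M[C]_n := \matrix_(i, j) A (enum_val i, enum_val j).

Definition tfold (M : 'M[C]_n) : tensor C d :=
  [ffun ij => M (enum_rank ij.1) (enum_rank ij.2)].

Lemma tunfoldK : cancel tunfold tfold.
Proof. by move=> A; apply/ffunP => -[i j]; rewrite ffunE mxE !enum_rankK. Qed.

Lemma tfoldK : cancel tfold tunfold.
Proof. by move=> M; apply/matrixP => i j; rewrite mxE ffunE !enum_valK. Qed.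

Lemma sum_enum_val (F : mindex d -> C) : \sum_i F i = \sum_(i < n) F (enum_val i).
Proof. by rewrite (reindex _ (onW_bij _ (@enum_val_bij (mindex d)))). Qed.

Lemma tunfoldB A B : tunfold (A - B) = tunfold A - tunfold B.
Proof. by apply/matrixP => i j; rewrite !mxE !ffunE. Qed.

Lemma tunfold_tmul A B : tunfold (tmul A B) = tunfold A *m tunfold B.
Proof.
apply/matrixP => i k; rewrite !mxE ffunE sum_enum_val.
by apply: eq_bigr => j _; rewrite !mxE.
Qed.

Lemma tunfold_tone : tunfold tone = 1%:M.
Proof.
apply/matrixP => i j; rewrite !mxE ffunE /= -(inj_eq enum_val_inj).
case: eqP => [->|ijN]; first by rewrite big1 // => k _; rewrite eqxx.
(* Distinct multi-indices differ in some coordinate, whose Kronecker factor kills the product. *)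
suff /existsP[k kN] : [exists k, enum_val i k != enum_val j k].
  by rewrite (bigD1 k) //= (negPf kN) mul0r.
apply: contra_notT ijN; rewrite negb_exists => /forallP ij.
by apply/ffunP => k; have /negPn/eqP := ij k.
Qed.

Lemma tunfold_tpow2 A : tunfold (tpow A 2) = tunfold A *m tunfold A.
Proof. by rewrite /tpow /= !tunfold_tmul tunfold_tone mulmx1. Qed.

Lemma tunfold_tadj A : tunfold (tadj A) = (tunfold A)^t*.
Proof. by apply/matrixP => i j; rewrite !mxE ffunE. Qed.

Lemma tunfold_herm A : thermitian A -> (tunfold A)^t* = tunfold A.
Proof. by move=> Ah; rewrite -tunfold_tadj Ah. Qed.

Lemma thermitianB A B : thermitian A -> thermitian B -> thermitian (A - B).
Proof.
move=> /tunfold_herm Ah /tunfold_herm Bh; apply: (can_inj tunfoldK).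
by rewrite tunfold_tadj tunfoldB linearB map_mxB /= Ah Bh.
Qed.

Lemma ttraceE A : ttrace A = \tr (tunfold A).
Proof. by rewrite /ttrace sum_enum_val; apply: eq_bigr => i _; rewrite mxE. Qed.

Lemma teigenvalueP A l :
  teigenvalue A l <-> exists2 v : 'cV[C]_n, v != 0 & tunfold A *m v = l *: v.
Proof.
split=> [[v vN0 Av]|[v vN0 Av]].
  exists (\col_i v (enum_val i)).
    apply: contra vN0 => /eqP/matrixP v0; apply/eqP/ffunP => i.
    by have := v0 (enum_rank i) 0; rewrite !mxE enum_rankK ffunE.
  apply/matrixP => i j; rewrite !mxE.
  have /ffunP/(_ (enum_val i)) := Av; rewrite !ffunE sum_enum_val => <-.
  by apply: eq_bigr => k _; rewrite !mxE.
exists [ffun i => v (enum_rank i) 0].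
  apply: contra vN0 => /eqP/ffunP v0; apply/eqP/matrixP => i j.
  by have := v0 (enum_val i); rewrite !ffunE enum_valK ord1 mxE.
apply/ffunP => i; rewrite !ffunE sum_enum_val.
have /matrixP/(_ (enum_rank i) 0) := Av; rewrite !mxE => <-.
by apply: eq_bigr => k _; rewrite mxE enum_rankK ffunE enum_valK.
Qed.

(** [teigenvalue] uses column vectors and [eigenvalue] row vectors; a matrix and its transpose share
    their characteristic polynomial. *)
Lemma teigenvalue_root A l : teigenvalue A l <-> root (char_poly (tunfold A)) l.
Proof.
have <- : char_poly (tunfold A)^T = char_poly (tunfold A).
  rewrite /char_poly -[RHS]det_tr; congr (\det _); apply/matrixP => i j.
  by rewrite !mxE eq_sym.
rewrite -eigenvalue_root_char; split=> [/teigenvalueP[v vN0 Av]|].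
  apply/eigenvalueP; exists v^T; last by rewrite trmx_eq0.
  by rewrite -trmx_mul Av linearZ.
move=> /eigenvalueP[v Av vN0]; apply/teigenvalueP; exists v^T.
  by rewrite trmx_eq0.
by apply: trmx_inj; rewrite trmx_mul trmxK Av linearZ /= trmxK.
Qed.

Lemma teigenvalueN A l : teigenvalue (- A) l <-> teigenvalue A (- l).
Proof.
have tappN v i : tapp (- A) v i = - tapp A v i.
  by rewrite !ffunE -sumrN; apply: eq_bigr => j _; rewrite ffunE mulNr.
split=> -[v vN0 /ffunP Av]; exists v => //; apply/ffunP => i.
  by apply: oppr_inj; rewrite -tappN Av !ffunE mulNr opprK.
by rewrite tappN Av !ffunE mulNr opprK.
Qed.

(** For an eigenvector [v], [l] is the quotient of the real number [v^* H v] by [v^* v > 0]. *)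
Lemma hermitian_eigenvalue_real H l :
  thermitian H -> teigenvalue H l -> l \is Num.real.
Proof.
move=> /tunfold_herm Hh /teigenvalueP[v /trC_mulmx_gt0 v_gt0 Hv].
have := hermitian_form_real v Hh.
rewrite -mulmxA Hv -scalemxAr mxE => lr.
rewrite -[l](mulfK (lt0r_neq0 v_gt0)) realM // realV ger0_real // ltW //.
Qed.

(** The roots for [- H] are the opposites of the eigenvalues of [H]. If these roots are nonpositive,
    every linear factor has nonnegative coefficients; conversely, a monic polynomial with
    nonnegative coefficients has no positive root. *)
Lemma tSPD_char_poly H : thermitian H ->
  tSPD H <-> forall k, 0 <= (char_poly (tunfold (- H)))`_k.
Proof.
move=> Hh; split=> [[_ H_ge0] k|p_ge0].
  have [s ps] := closed_field_poly_normal (char_poly (tunfold (- H))).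
  have s_le0 z : z \in s -> 0 <= - z.
    move=> zs; apply/H_ge0/teigenvalueN/teigenvalue_root.
    by rewrite ps rootZ ?root_prod_XsubC // lead_coef_eq0 monic_neq0 ?char_poly_monic.
  rewrite ps (monicP (char_poly_monic _)) scale1r.
  elim: s s_le0 k {ps} => [|z s IHs] s_le0 k.
    by rewrite big_nil coef1 ler0n.
  have {}IHs := IHs (fun y ys => s_le0 y (@mem_behead _ (z :: s) y ys)).
  rewrite big_cons mulrBl coefB coefXM coefCM addr_ge0 //.
    by case: eqP.
  by rewrite -mulNr mulr_ge0 // s_le0 ?mem_head.
split=> // l Hl; have lr := hermitian_eigenvalue_real Hh Hl.
rewrite real_leNgt ?real0 //; apply/negP => l_lt0.
have : root (char_poly (tunfold (- H))) (- l).
  by apply/teigenvalue_root/teigenvalueN; rewrite opprK.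
apply/negP; rewrite /root horner_coef.
have /monicP := char_poly_monic (tunfold (- H)); rewrite /lead_coef.
rewrite size_char_poly /= => lead1.
(* The leading term, with coefficient 1, makes the value at [- l] strictly positive; the other terms
   are nonnegative. *)
rewrite big_ord_recr /= lead1 mul1r gt_eqF // ltr_wpDl ?exprn_gt0 ?oppr_gt0 //.
by apply: sumr_ge0 => i _; rewrite mulr_ge0 // exprn_ge0 // oppr_ge0 ltW.
Qed.

Section PositiveDefiniteTensor.
Variable A : tensor C d.
Hypothesis A_PD : tPD A.

Let A_herm : (tunfold A)^t* = tunfold A.
Proof. by case: A_PD => /tunfold_herm. Qed.

Let A_pos l : eigenvalue (tunfold A) l -> 0 < l.
Proof.
by rewrite eigenvalue_root_char => ?; apply: (proj2 A_PD); apply/teigenvalue_root.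
Qed.

Lemma tunfold_tinv : tunfold (tinv A) = invmx (tunfold A).
Proof.
have uA := posdef_unitmx A_herm A_pos.
have [AB _] : tmul A (tinv A) = tone /\ tmul (tinv A) A = tone.
  (* The folded inverse matrix shows the set inhabited, so [xget] does not fall back on its default
     0. *)
  apply: (@xgetPex _ 0 [set B | tmul A B = tone /\ tmul B A = tone]%classic).
  exists (tfold (invmx (tunfold A))).
  by split; apply: (can_inj tunfoldK); rewrite tunfold_tmul tunfold_tone tfoldK
     ?mulmxV ?mulVmx.
by rewrite -[LHS](mulKmx uA) -tunfold_tmul AB tunfold_tone mulmx1.
Qed.

Lemma ttrace_tpow2E X : ttrace (tmul (tpow X 2) (tpow (tinv A) 2)) =
  \tr (tunfold X *m tunfold X *m (invmx (tunfold A) *m invmx (tunfold A))).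
Proof. by rewrite ttraceE tunfold_tmul !tunfold_tpow2 tunfold_tinv. Qed.

Lemma ttrace_tpow2_ge0 X : thermitian X ->
  0 <= ttrace (tmul (tpow X 2) (tpow (tinv A) 2)).
Proof. by move=> /tunfold_herm Xh; rewrite ttrace_tpow2E trace_sqr_ge0. Qed.

(** An eigenvector of [A - X] for a negative eigenvalue is a vector at which the form of [X] exceeds
    that of [A]. *)
Lemma ttrace_tpow2_ge1 X : thermitian X -> ~ tle X A ->
  1 <= ttrace (tmul (tpow X 2) (tpow (tinv A) 2)).
Proof.
move=> Xh XA; rewrite ttrace_tpow2E.
have AXh : thermitian (A - X) by apply: thermitianB => //; case: A_PD.
have [l AXl lN0] : exists2 l, teigenvalue (A - X) l & ~ 0 <= l.
  apply: contra_notP XA => /forall2NP XA; split=> // l AXl.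
  by case: (XA l) => // /contrapT.
(* The order of [C] is partial: the failure of [0 <= l] yields [l < 0] because [l] is real. *)
have l_lt0 : l < 0.
  by rewrite real_ltNge ?real0 ?(hermitian_eigenvalue_real AXh) //; apply/negP.
have /teigenvalueP[v /trC_mulmx_gt0 v_gt0 AXv] := AXl.
apply: (@trace_sqr_ge1 _ _ _ A_herm A_pos _ (tunfold_herm Xh) v).
have := congr1 (fun z => (v^t* *m z) 0 0) AXv.
rewrite tunfoldB mulmxBl mulmxBr !mulmxA -scalemxAr.
rewrite [RHS]mxE mxE [X in _ + X]mxE => AXvv.
by rewrite -subr_lt0 AXvv nmulr_rlt0.
Qed.

End PositiveDefiniteTensor.
End Unfolding.

(** * Measurability and expectation of complex random variables *)

Section ComplexRandomVariables.
Context (disp : measure_display) (T : measurableType disp) (R : realType).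
Variable P : probability T R.
Implicit Types (Y Z : T -> R[i]) (c : R[i]).

Lemma cmeasurable_cst c : cmeasurable (fun _ : T => c).
Proof. by split; exact: measurable_cst. Qed.

Lemma cmeasurableD Y Z : cmeasurable Y -> cmeasurable Z ->
  cmeasurable (fun w => Y w + Z w).
Proof.
move=> [mY1 mY2] [mZ1 mZ2]; split.
  rewrite (_ : (fun w => _) = (fun w => complex.Re (Y w) + complex.Re (Z w))).
    exact: measurable_funD.
  by apply/funext => w; case: (Y w) (Z w) => [? ?] [? ?].
rewrite (_ : (fun w => _) = (fun w => complex.Im (Y w) + complex.Im (Z w))).
  exact: measurable_funD.
by apply/funext => w; case: (Y w) (Z w) => [? ?] [? ?].
Qed.

Lemma cmeasurableM Y Z : cmeasurable Y -> cmeasurable Z ->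
  cmeasurable (fun w => Y w * Z w).
Proof.
move=> [mY1 mY2] [mZ1 mZ2]; split.
  rewrite (_ : (fun w => _) = (fun w => complex.Re (Y w) * complex.Re (Z w)
                                      - complex.Im (Y w) * complex.Im (Z w))).
    by apply: measurable_funB; apply: measurable_funM.
  by apply/funext => w; case: (Y w) (Z w) => [? ?] [? ?].
rewrite (_ : (fun w => _) = (fun w => complex.Re (Y w) * complex.Im (Z w)
                                    + complex.Im (Y w) * complex.Re (Z w))).
  by apply: measurable_funD; apply: measurable_funM.
by apply/funext => w; case: (Y w) (Z w) => [? ?] [? ?].
Qed.

Lemma cmeasurable_sum (I : Type) (r : seq I) (Q : pred I) (Y : I -> T -> R[i]) :
  (forall i, cmeasurable (Y i)) -> cmeasurable (fun w => \sum_(i <- r | Q i) Y i w).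
Proof.
move=> mY; elim: r => [|i r IHr].
  by under eq_fun do rewrite big_nil; exact: cmeasurable_cst.
under eq_fun do rewrite big_cons.
by case: (Q i) => //; exact: cmeasurableD.
Qed.

(** The order of [R[i]] splits the condition into a closed half-line for the real part and a point
    for the imaginary part. *)
Lemma measurable_cge0 Y : cmeasurable Y -> measurable [set w | 0 <= Y w]%classic.
Proof.
move=> [mYr mYi].
have -> : [set w | 0 <= Y w]%classic =
    ([set: T] `&` (fun w => complex.Re (Y w)) @^-1` `[0, +oo[ `&`
    ([set: T] `&` (fun w => complex.Im (Y w)) @^-1` [set 0]))%classic.
  apply/seteqP; split=> w /=; rewrite lecE /= in_itv /= andbT.
    by move=> /andP[/eqP -> ->].
  by move=> [[_ ->] [_ ->]]; rewrite eqxx.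
apply: measurableI; first by apply: mYr => //; exact: measurable_itv.
by apply: mYi => //; exact: measurable_set1.
Qed.

(** Working coefficientwise makes sums and products of polynomials safe, as their coefficients are
    finite sums of products. *)
Definition poly_cmeasurable (p : T -> {poly R[i]}) : Prop :=
  forall k, cmeasurable (fun w => (p w)`_k).

Lemma poly_cmeasurable_cst (p : {poly R[i]}) : poly_cmeasurable (fun=> p).
Proof. by move=> k; exact: cmeasurable_cst. Qed.

Lemma poly_cmeasurableC Y : cmeasurable Y -> poly_cmeasurable (fun w => (Y w)%:P).
Proof.
move=> mY k; under eq_fun do rewrite coefC.
by case: (k == 0)%N => //; exact: cmeasurable_cst.
Qed.

Lemma poly_cmeasurableD p q : poly_cmeasurable p -> poly_cmeasurable q ->
  poly_cmeasurable (fun w => p w + q w).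
Proof. by move=> mp mq k; under eq_fun do rewrite coefD; exact: cmeasurableD. Qed.

Lemma poly_cmeasurableM p q : poly_cmeasurable p -> poly_cmeasurable q ->
  poly_cmeasurable (fun w => p w * q w).
Proof.
move=> mp mq k; under eq_fun do rewrite coefM.
by apply: cmeasurable_sum => i; exact: cmeasurableM.
Qed.

(** The Leibniz formula gives a finite signed sum of products of entries of ['X%:M - M w], each
    coefficientwise measurable. *)
Lemma poly_cmeasurable_char_poly n (M : T -> 'M[R[i]]_n) :
  (forall i j, cmeasurable (fun w => M w i j)) ->
  poly_cmeasurable (fun w => char_poly (M w)).
Proof.
move=> mM; rewrite /char_poly /determinant => k.
under eq_fun do rewrite coef_sum.
apply: cmeasurable_sum => s.
apply: (poly_cmeasurableM (poly_cmeasurable_cst _) _ k).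
elim: (index_enum _) => [|i r IHr].
  by under eq_fun do rewrite big_nil; exact: poly_cmeasurable_cst.
under eq_fun do rewrite big_cons.
apply: poly_cmeasurableM => //; under eq_fun do rewrite !mxE -polyCN.
apply: poly_cmeasurableD; first exact: poly_cmeasurable_cst.
apply: poly_cmeasurableC; under eq_fun do rewrite -mulN1r.
by apply: cmeasurableM => //; exact: cmeasurable_cst.
Qed.

(** Integrability makes both expectations finite, so that [fine] commutes with the sum. *)
Let expectationD_fine (f g : T -> R) :
    P.-integrable setT (EFin \o f) -> P.-integrable setT (EFin \o g) ->
  fine 'E_P[f \+ g] = fine 'E_P[f] + fine 'E_P[g].
Proof.
move=> /Lfun1_integrable fi /Lfun1_integrable gi.
by rewrite expectationD // fineD // expectation_fin_num.
Qed.

Let expectationZ_fine (f : T -> R) (r : R) : P.-integrable setT (EFin \o f) ->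
  fine 'E_P[r \o* f] = r * fine 'E_P[f].
Proof.
move=> /Lfun1_integrable fi.
by rewrite expectationZl // fineM // expectation_fin_num.
Qed.

Let integrableZ_fin (f : T -> R) (r : R) : P.-integrable setT (EFin \o f) ->
  P.-integrable setT (EFin \o (r \o* f)).
Proof.
move=> /(integrableZl measurableT r); apply: eq_integrable => // w _ /=.
by rewrite mulrC EFinM.
Qed.

Let integrableD_fin (f g : T -> R) :
    P.-integrable setT (EFin \o f) -> P.-integrable setT (EFin \o g) ->
  P.-integrable setT (EFin \o (f \+ g)).
Proof. by move=> fi gi; apply: eq_integrable (integrableD measurableT fi gi). Qed.

Lemma cintegrableD Y Z : cintegrable P Y -> cintegrable P Z ->
  cintegrable P (fun w => Y w + Z w).
Proof.
move=> [Y1 Y2] [Z1 Z2]; split.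
  apply: eq_integrable (integrableD_fin Y1 Z1) => // w _ /=.
  by case: (Y w) (Z w) => [? ?] [? ?].
apply: eq_integrable (integrableD_fin Y2 Z2) => // w _ /=.
by case: (Y w) (Z w) => [? ?] [? ?].
Qed.

Lemma cexpectationD Y Z : cintegrable P Y -> cintegrable P Z ->
  cexpectation P (fun w => Y w + Z w) = cexpectation P Y + cexpectation P Z.
Proof.
move=> [Y1 Y2] [Z1 Z2]; rewrite /cexpectation; apply/eqP.
rewrite eq_complex /= -!expectationD_fine //; apply/andP; split; apply/eqP;
  congr (fine 'E_P[_]); apply/funext => w /=;
  by case: (Y w) (Z w) => [? ?] [? ?].
Qed.

Lemma cintegrableZ Y c : cintegrable P Y -> cintegrable P (fun w => Y w * c).
Proof.
case: c => a b [Y1 Y2]; split.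
  apply: eq_integrable (integrableD_fin (integrableZ_fin a Y1)
    (integrableZ_fin (- b) Y2)) => // w _ /=.
  by case: (Y w) => ? ? /=; rewrite mulrN.
apply: eq_integrable (integrableD_fin (integrableZ_fin b Y1)
  (integrableZ_fin a Y2)) => // w _ /=.
by case: (Y w).
Qed.

Lemma cexpectationZ Y c : cintegrable P Y ->
  cexpectation P (fun w => Y w * c) = cexpectation P Y * c.
Proof.
case: c => a b [Y1 Y2]; rewrite /cexpectation; apply/eqP.
rewrite eq_complex /= ![fine _ * _]mulrC -mulNr.
rewrite -!expectationZ_fine // -!expectationD_fine; [|exact: integrableZ_fin..].
by apply/andP; split; apply/eqP; congr (fine 'E_P[_]); apply/funext => w /=;
  case: (Y w) => ? ? /=; rewrite ?mulrN.
Qed.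

(** One induction proves both claims, since additivity at each step calls for integrability of the
    remaining sum. *)
Lemma cintegrable_cexpectation_sum (I : Type) (r : seq I) (Y : I -> T -> R[i]) :
  (forall i, cintegrable P (Y i)) ->
  cintegrable P (fun w => \sum_(i <- r) Y i w) /\
  cexpectation P (fun w => \sum_(i <- r) Y i w) = \sum_(i <- r) cexpectation P (Y i).
Proof.
move=> iY; elim: r => [|i r [IHi IHe]].
  under eq_fun do rewrite big_nil; rewrite big_nil; split.
    by split; exact: integrable0.
  by rewrite /cexpectation /= (_ : (fun w => _) = cst 0) ?(expectation_cst P 0).
under eq_fun do rewrite big_cons; rewrite big_cons; split.
  exact: cintegrableD.
by rewrite cexpectationD // IHe.
Qed.

(** The real part of [Y] dominates the indicator of [B], and expectation is monotone. *)
Lemma cmarkov (B : set T) Y : measurable B -> cintegrable P Y ->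
    (forall w, 0 <= Y w) -> (forall w, B w -> 1 <= Y w) ->
  (fine (P B))%:C <= cexpectation P Y.
Proof.
move=> mB [iY _] Y_ge0 Y_ge1.
have ReY_ge0 w : 0 <= complex.Re (Y w).
  by have := Y_ge0 w; rewrite lecE => /andP[].
rewrite lecE /=; apply/andP; split.
  (* Comparison in [R[i]] also demands equal imaginary parts; that of [Y] vanishes because
     [0 <= Y w]. *)
  rewrite (_ : (fun w => _) = cst 0) ?(expectation_cst P 0) //.
  by apply/funext => w; exact: ger0_Im.
rewrite -(expectation_indic P mB); apply: fine_le.
- by rewrite expectation_indic // fin_num_measure.
- by apply: expectation_fin_num; apply/Lfun1_integrable.
apply: expectation_le => //.
- by apply/measurable_EFinP; exact: measurable_int iY.
- apply: aeW => w; rewrite indicE; case: (boolP (w \in B)) => [|_] //.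
  by rewrite inE => /Y_ge1; rewrite lecE => /andP[].
Qed.

End ComplexRandomVariables.

Lemma measurable_tle (disp : measure_display) (T : measurableType disp)
    (R : realType) (N : nat) (d : 'I_N -> nat)
    (A : tensor R[i] d) (X : T -> tensor R[i] d) :
  thermitian A -> random_tensor X -> (forall w, thermitian (X w)) ->
  measurable [set w | tle (X w) A]%classic.
Proof.
move=> Ah mX Xh.
(* Indices [k] beyond the degree only contribute [0 <= 0], so the intersection may run over all
   naturals. *)
have -> : [set w | tle (X w) A]%classic = (\bigcap_k
    [set w | 0 <= (char_poly (tunfold (- (A - X w))))`_k])%classic.
  apply/seteqP; split=> w /=.
    by move=> /(tSPD_char_poly (thermitianB Ah (Xh w))) + k _; apply.
  move=> XA; apply/(tSPD_char_poly (thermitianB Ah (Xh w))) => k; exact: XA.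
apply: bigcapT_measurable => k; apply: measurable_cge0.
apply: poly_cmeasurable_char_poly => i j.
under eq_fun do rewrite mxE opprB !ffunE.
by apply: cmeasurableD => //; exact: cmeasurable_cst.
Qed.

Theorem theorem2 (disp : measure_display) (T : measurableType disp)
    (R : realType) (P : probability T R) (N : nat) (d : 'I_N -> nat)
    (A : tensor R[i] d) (X : T -> tensor R[i] d)
    (A_PD : tPD A)
    (X_random : random_tensor X)
    (X_herm : forall w, thermitian (X w))
    (X2_int : tintegrable P (fun w => tpow (X w) 2)) :
  (fine (P [set w | ~ tle (X w) A]%classic))%:C
    <= ttrace (tmul (texpectation P (fun w => tpow (X w) 2)) (tpow (tinv A) 2)).
Proof.
set B := tpow (tinv A) 2.
pose g w := ttrace (tmul (tpow (X w) 2) B).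
(* This is a linear combination of the entries of the square with deterministic coefficients, ready
   for linearity of the expectation. *)
have gE : g = fun w => \sum_i \sum_j tpow (X w) 2 (i, j) * B (j, i).
  by apply/funext => w; apply: eq_bigr => i _; rewrite ffunE.
have iXB i j : cintegrable P (fun w => tpow (X w) 2 (i, j) * B (j, i)).
  exact: cintegrableZ.
have sum_i i := cintegrable_cexpectation_sum (index_enum _) (iXB i).
have [ig Eg] := cintegrable_cexpectation_sum (index_enum _) (fun i => proj1 (sum_i i)).
have -> : ttrace (tmul (texpectation P (fun w => tpow (X w) 2)) B) =
    cexpectation P g.
  rewrite gE Eg; apply: eq_bigr => i _; rewrite (proj2 (sum_i i)) ffunE.
  by apply: eq_bigr => j _; rewrite ffunE cexpectationZ.
(* Markov's inequality at threshold 1: [g] is nonnegative everywhere and at least 1 on the event. *)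
apply: cmarkov; last 2 first.
- by move=> w; exact: ttrace_tpow2_ge0.
- by move=> w; exact: ttrace_tpow2_ge1.
- by apply: measurableC; apply: measurable_tle => //; case: A_PD.
- by rewrite gE.
Qed.
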